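(* Let $q>0$, $q\ne1$, let $1\le k\le N$, and let $\lambda=(\lambda_1\ge\cdots\ge\lambda_N)$ be a signature of size $N$. Then, as an identity of rational functions in $x_1,\dots,x_k$, $$S_\lambda(x_1,\dots,x_k;N,q)=\frac{q^{\binom{k+1}{3}-(N-1)\binom k2}\prod_{i=1}^k[N-i]_q!}{\prod_{i=1}^k\prod_{j=1}^{N-k}(x_i-q^{j-1})}\cdot\frac{\det\bigl[D_{i,q}^{\,j-1}\bigr]_{i,j=1}^k}{\Delta(x_1,\dots,x_k)}\prod_{i=1}^k\frac{S_\lambda(x_i;N,q)\prod_{j=1}^{N-1}(x_i-q^{j-1})}{[N-1]_q!},$$ where $D_{i,q}$ is the difference operator acting on a function $f(x_i)$ of the variable $x_i$ by $$[D_{i,q}f](x_i)=\frac{f(qx_i)-f(x_i)}{q-1},$$ and the operator $\det[D_{i,q}^{j-1}]$ acts on the product over $i$ to its right (and the result is then divided by $\Delta$).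
   Context: A signature of size $N$ is an $N$-tuple of integers $\lambda_1\ge\cdots\ge\lambda_N$. $\Delta(x_1,\dots,x_k)=\prod_{i<j}(x_i-x_j)$. The rational Schur function is the symmetric Laurent polynomial $s_\lambda(u_1,\dots,u_N)=\det[u_i^{\lambda_j+N-j}]_{i,j=1}^N/\Delta(u_1,\dots,u_N)$, and $$S_\lambda(x_1,\dots,x_k;N,q)=\frac{s_\lambda(x_1,\dots,x_k,1,q,q^2,\dots,q^{N-1-k})}{s_\lambda(1,q,\dots,q^{N-1})}.$$ $[m]_q=\frac{q^m-1}{q-1}$, $[a]_q!=\prod_{m=1}^a[m]_q$. The operators $D_{1,q},\dots,D_{k,q}$ commute, so the determinant is well defined. *)

(* Defs.v *)
From HB Require Import structures.
From mathcomp Require Import all_boot all_order all_fingroup all_algebra.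
From mathcomp Require Import generic_quotient mpoly.

Set Implicit Arguments.
Unset Strict Implicit.
Unset Printing Implicit Defensive.

Import Order.TTheory GRing.Theory Num.Theory.
Local Open Scope ring_scope.

Definition signature (N : nat) (lam : 'I_N -> int) : Prop :=
  forall i j : 'I_N, (i <= j)%N -> lam j <= lam i.

Section Schur.

Context {F : fieldType}.

Definition vandermonde (n : nat) (u : 'I_n -> F) : F :=
  \prod_(i < n) \prod_(j < n | (i < j)%N) (u i - u j).

(* Value of the rational Schur function at nonzero, pairwise distinct points
   (elsewhere the quotient is not the value of the Laurent polynomial).  Below
   it is only evaluated at such points: the formal variables and powers of q.
   The index j starts at 0, so lam j + (N - j.+1) is lambda_j + N - j. *)
Definition schur (N : nat) (lam : 'I_N -> int) (u : 'I_N -> F) : F :=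
  \det (\matrix_(i < N, j < N) u i ^ (lam j + (N - j.+1)%:Z)) / vandermonde u.

(* (x_1, ..., x_k, 1, q, ..., q^(N-1-k)) with k = size xs <= N *)
Definition pad (q : F) (N : nat) (xs : seq F) : 'I_N -> F :=
  fun i => nth 0 (xs ++ [seq q ^+ m | m <- iota 0 (N - size xs)]) i.
Arguments pad q N xs i : clear implicits.

Definition normSchur (q : F) (N : nat) (lam : 'I_N -> int) (xs : seq F) : F :=
  schur lam (pad q N xs) / schur lam (pad q N [::]).

Definition qnum (q : F) (m : nat) : F := (q ^+ m - 1) / (q - 1).

Definition qfact (q : F) (a : nat) : F := \prod_(1 <= m < a.+1) qnum q m.

(* Leibniz formula for the determinant of a matrix of operators, the product of
   operators being composition. Its value does not depend on the order of the
   factors when operators in different rows commute (see [qdiff_comm]). *)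
Definition opdet (k : nat) (A : 'I_k -> 'I_k -> F -> F) (f : F) : F :=
  \sum_(s : 'S_k) (-1) ^+ s * (\big[@comp F F F/idfun]_(i < k) A i (s i)) f.

End Schur.

Notation ratfun R k := {fraction {mpoly R[k]}}.

Section RationalFunctions.

Context {R : fieldType} {k : nat}.

Definition rfconst (c : R) : ratfun R k := tofrac (c%:MP_[k]).

Definition rfvar (i : 'I_k) : ratfun R k := tofrac 'X_i.

(* p(x_1, ..., x_k) |-> p(x_1, ..., q x_i, ..., x_k) *)
Definition mpqshift (q : R) (i : 'I_k) (p : {mpoly R[k]}) : {mpoly R[k]} :=
  p \mPo [tuple (if j == i then q *: 'X_j else 'X_j) | j < k].

(* The extension of [mpqshift] to fractions. It goes through a representative
   of f; [qshift_div] shows that the choice is immaterial for q != 0. *)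
Definition qshift (q : R) (i : 'I_k) (f : ratfun R k) : ratfun R k :=
  tofrac (mpqshift q i \n_(repr f)) / tofrac (mpqshift q i \d_(repr f)).

Definition qdiff (q : R) (i : 'I_k) (f : ratfun R k) : ratfun R k :=
  (qshift q i f - f) / (rfconst q - 1).

Lemma mpqshiftX q i j :
  mpqshift q i 'X_j = if j == i then q *: 'X_j else 'X_j.
Proof. by rewrite /mpqshift comp_mpolyXU -tnth_nth tnth_mktuple. Qed.

HB.instance Definition _ q i := GRing.RMorphism.copy (mpqshift q i)
  (comp_mpoly [tuple (if j == i then q *: 'X_j else 'X_j) | j < k]).

Lemma mpqshiftC q i c : mpqshift q i c%:MP = c%:MP.
Proof. exact: comp_mpolyC. Qed.

Lemma mpqshiftZ q i c p : mpqshift q i (c *: p) = c *: mpqshift q i p.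
Proof. exact: comp_mpolyZ. Qed.

Lemma mpoly_morph_eq (g h : {rmorphism {mpoly R[k]} -> {mpoly R[k]}}) :
  (forall c, g c%:MP = h c%:MP) -> (forall j, g 'X_j = h 'X_j) -> g =1 h.
Proof.
move=> gC gX p; rewrite [p]mpolyE !rmorph_sum; apply: eq_bigr => m _.
rewrite -mul_mpolyC !rmorphM /= gC; congr (_ * _).
rewrite (mpolyXE _ 1%g) !rmorph_prod; apply: eq_bigr => j _.
by rewrite !rmorphXn !gX.
Qed.

Lemma mpqshiftK q i : q != 0 -> cancel (mpqshift q i) (mpqshift q^-1 i).
Proof.
move=> q0.
apply: (mpoly_morph_eq (g := mpqshift q^-1 i \o mpqshift q i) (h := idfun)).
  by move=> c /=; rewrite !mpqshiftC.
move=> j /=; rewrite mpqshiftX; case: ifP => ji; last by rewrite mpqshiftX ji.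
by rewrite mpqshiftZ mpqshiftX ji scalerA divff ?scale1r.
Qed.

Lemma mpqshift_comm p q i j :
  mpqshift p i \o mpqshift q j =1 mpqshift q j \o mpqshift p i.
Proof.
apply: mpoly_morph_eq => [c|l] /=; first by rewrite !mpqshiftC.
rewrite !mpqshiftX; case: ifP => lj; case: ifP => li;
  rewrite ?(mpqshiftZ, mpqshiftX, lj, li) //.
by rewrite !scalerA mulrC.
Qed.

Lemma mpqshift_eq0 q i p : q != 0 -> (mpqshift q i p == 0) = (p == 0).
Proof. by move=> q0; rewrite -[RHS](inj_eq (can_inj (mpqshiftK i q0))) rmorph0. Qed.

Lemma ratfun_repr (f : ratfun R k) :
  f = tofrac \n_(repr f) / tofrac \d_(repr f).
Proof.
rewrite -[f in LHS]reprK; move: (repr f) => r.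
have d0 := denom_ratioP r.
apply: (canRL (mulfK _)); first by rewrite tofrac_eq0.
rewrite /tofrac; unlock FracField.tofrac.
rewrite -[_ * _]FracField.pi_mul; apply/eqmodP => /=.
rewrite FracField.equivfE /FracField.mulf.
by rewrite !numden_Ratio ?mulr1 ?oner_neq0 // mulrC.
Qed.

Lemma qshift_div q i (n d : {mpoly R[k]}) : q != 0 -> d != 0 ->
  qshift q i (tofrac n / tofrac d)
  = tofrac (mpqshift q i n) / tofrac (mpqshift q i d).
Proof.
move=> q0 d0; rewrite /qshift; set f := _ / tofrac d.
have rd0 := denom_ratioP (repr f).
apply/eqP; rewrite eqr_div ?tofrac_eq0 ?mpqshift_eq0 //.
rewrite -!tofracM tofrac_eq -!rmorphM; apply/eqP; congr (mpqshift q i _).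
apply/eqP; rewrite -tofrac_eq !tofracM -eqr_div ?tofrac_eq0 //.
by rewrite -ratfun_repr.
Qed.

Lemma ratfunP (f : ratfun R k) :
  exists n d, d != 0 /\ f = tofrac n / tofrac d.
Proof.
exists \n_(repr f), \d_(repr f); split; first exact: denom_ratioP.
exact: ratfun_repr.
Qed.

Lemma qshift_tofrac q i (p : {mpoly R[k]}) : q != 0 ->
  qshift q i (tofrac p) = tofrac (mpqshift q i p).
Proof.
move=> q0; rewrite -[tofrac p]divr1 -tofrac1 qshift_div ?oner_neq0 //.
by rewrite rmorph1 tofrac1 divr1.
Qed.

Lemma qshiftM q i (f g : ratfun R k) : q != 0 ->
  qshift q i (f * g) = qshift q i f * qshift q i g.
Proof.
move=> q0; have [n [d [d0 ->]]] := ratfunP f; have [m [e [e0 ->]]] := ratfunP g.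
rewrite mulf_div -!tofracM !qshift_div ?mulf_neq0 //.
by rewrite mulf_div !rmorphM.
Qed.

Lemma qshiftB q i (f g : ratfun R k) : q != 0 ->
  qshift q i (f - g) = qshift q i f - qshift q i g.
Proof.
move=> q0; have [n [d [d0 ->]]] := ratfunP f; have [m [e [e0 ->]]] := ratfunP g.
rewrite -mulNr addf_div ?tofrac_eq0 // -tofracN -!tofracM -tofracD.
rewrite !qshift_div ?mulf_neq0 // -mulNr addf_div ?tofrac_eq0 ?mpqshift_eq0 //.
by rewrite !(rmorphM, rmorphD, rmorphN).
Qed.

Lemma qshift_const q i c : q != 0 -> qshift q i (rfconst c) = rfconst c.
Proof. by move=> q0; rewrite qshift_tofrac // mpqshiftC. Qed.

Lemma qshift_comm q i j (f : ratfun R k) : q != 0 ->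
  qshift q i (qshift q j f) = qshift q j (qshift q i f).
Proof.
move=> q0; have [n [d [d0 ->]]] := ratfunP f.
have E a b : qshift q a (qshift q b (tofrac n / tofrac d))
    = tofrac (mpqshift q a (mpqshift q b n))
      / tofrac (mpqshift q a (mpqshift q b d)).
  by rewrite (qshift_div b) // qshift_div ?mpqshift_eq0.
have C p := mpqshift_comm q q i j p; rewrite /= in C.
by rewrite !E !C.
Qed.

Lemma qdiff_comm q i j (f : ratfun R k) : q != 0 ->
  qdiff q i (qdiff q j f) = qdiff q j (qdiff q i f).
Proof.
move=> q0; rewrite /qdiff.
have Ec : (rfconst q - 1)^-1 = tofrac 1 / tofrac (q%:MP_[k] - 1).
  by rewrite tofracB tofrac1 div1r.
have shc l : qshift q l (rfconst q - 1)^-1 = (rfconst q - 1)^-1.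
  have [q1|q1] := eqVneq (q%:MP_[k] - 1) 0.
    by rewrite /rfconst -tofrac1 -tofracB q1 tofrac0 invr0 -tofrac0
      qshift_tofrac ?rmorph0.
  by rewrite Ec qshift_div // rmorphB !rmorph1 /= mpqshiftC.
rewrite !qshiftM // !qshiftB // !shc qshift_comm //.
rewrite -!mulrBl; congr (_ / _ / _).
by rewrite !opprB addrACA [RHS]addrACA; congr (_ + _); rewrite addrC.
Qed.

End RationalFunctions.

(* Main.v *)
(** Write y_j = q^(l_j) with l_j = lambda_j + N - j, let Y be the Vandermonde
    matrix with rows y^(N-1), ..., y, 1, and let B be the matrix with rows
    (x_i^(l_j))_j Y^-1.  The rows of the numerator of s_lambda coming from
    1, q, q^2, ... are the last rows of Y in reverse order, so the numerator is
    the leading k x k minor of B, up to a factor independent of the x_i; for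
    k = 1 it is the first entry b of B.  The q-shift in x_i multiplies x_i^(l_j)
    by y_j, hence acts on the i-th row of B as the companion matrix
    Y diag(y) Y^-1: it sends the m-th entry to the (m+1)-st one plus a constant
    multiple of b.  Therefore D_i^m b(x_i) is a unitriangular combination, up to
    the scalars (q-1)^-m, of the entries of B, with coefficients that do not
    depend on i, and det (D_i^j b(x_i)) is that minor up to a power of q-1. *)
From HB Require Import structures.
Require Import Defs.
From mathcomp Require Import all_boot all_order all_fingroup all_algebra.
From mathcomp Require Import mpoly ring zify.

Set Implicit Arguments.
Unset Strict Implicit.
Unset Printing Implicit Defensive.

Import Order.TTheory GRing.Theory Num.Theory.
Local Open Scope ring_scope.

(** Used with n = N - k: then C(n, 2) - C(N, 2) = C(k+1, 2) - N k, the growth of the exponent of q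
    in the induction of [qdelta_ratio]. *)
Lemma bin2_addn (n k : nat) :
  ('C(n, 2) + (k + n) * k = 'C(k.+1, 2) + 'C(k + n, 2))%N.
Proof.
elim: k => [|k IHk]; first by rewrite muln0 addn0 add0n.
by rewrite addSn (binS k.+1) (binS (k + n)) !bin1; move: IHk; nia.
Qed.

(** * Block determinants and Vandermonde products at powers of q *)

Section Alternants.

Variable F : fieldType.

(** Antidiagonal permutation matrix; it passes between the decreasing exponents of Y and the
    increasing ones of 1, q, q^2, ... *)
Definition revmx (n : nat) : 'M[F]_n :=
  \matrix_(i, j) (i + j.+1 == n)%N%:R.

Lemma det_revmx (n : nat) : \det (revmx n) = (-1) ^+ 'C(n, 2).
Proof.
elim: n => [|n IHn]; first by rewrite det_mx00.
rewrite (expand_det_row _ ord0) (bigD1 ord_max) //= big1 ?addr0.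
  rewrite !mxE add0n eqxx mul1r /cofactor add0n binS bin1 exprD mulrC -IHn.
  congr (\det _ * _); apply/matrixP => i j; rewrite !mxE /=.
  by rewrite /bump (leqNgt n) ltn_ord add0n add1n addSn eqSS.
move=> j jn; rewrite mxE add0n eqSS.
suff -> : (j == n :> nat) = false by rewrite mul0r.
by apply/negbTE.
Qed.

Lemma det_revmx_neq0 n : \det (revmx n) != 0.
Proof. by rewrite det_revmx signr_eq0. Qed.

Lemma revmx_mul (n m : nat) (f : nat -> 'I_m -> F) :
  revmx n *m (\matrix_(i, j) f (n - i.+1)%N j) = \matrix_(i, j) f i j.
Proof.
apply/matrixP => i j; rewrite !mxE (bigD1 (rev_ord i)) //= big1 ?addr0.
  by rewrite !mxE /= -subSn // subSS addnC subnK ?(ltnW (ltn_ord i)) //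
    eqxx mul1r subKn ?(ltnW (ltn_ord i)).
move=> p pi; rewrite !mxE; suff -> : (i + p.+1 == n)%N = false by rewrite mul0r.
apply: contra_neqF pi => /eqP e; apply: val_inj => /=.
by move/(congr1 (subn^~ i.+1)): e => /= <-; rewrite -addSnnS addKn.
Qed.

(** Entries come from a function on nat, so that writing N as k + (N - k) needs no casts of
    ordinals. *)
Lemma det_block_nat (N k : nat) (f : nat -> nat -> F) : (k <= N)%N ->
  (forall i j, (k <= i < N)%N -> (j < k)%N -> f i j = 0) ->
  \det (\matrix_(i < N, j < N) f i j) =
  \det (\matrix_(i < k, j < k) f i j)
  * \det (\matrix_(i < N - k, j < N - k) f (k + i)%N (k + j)%N).
Proof.
move=> kN; move: (subnKC kN); move: (N - k)%N => n eN f0; subst N.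
have e0 : dlsubmx (\matrix_(i < k + n, j < k + n) f i j) = 0.
  by apply/matrixP => i j; rewrite !mxE /= f0 // leq_addr ltn_add2l ltn_ord.
rewrite -[X in \det X]submxK e0 det_ublock.
by congr (_ * _); congr (\det _); apply/matrixP => i j; rewrite !mxE.
Qed.

Lemma vandermonde_split (m n : nat) (u : 'I_(m + n) -> F) :
  vandermonde u = vandermonde (fun i => u (lshift n i))
    * (\prod_(i < m) \prod_(j < n) (u (lshift n i) - u (rshift m j)))
    * vandermonde (fun j => u (rshift m j)).
Proof.
rewrite /vandermonde big_split_ord /=; congr (_ * _).
  rewrite -big_split /=; apply: eq_bigr => i _; rewrite big_split_ord /=.
  congr (_ * _); apply: eq_bigl => j /=.
  by rewrite ltn_addr.
apply: eq_bigr => i _; rewrite big_split_ord /= big1 ?mul1r.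
  by apply: eq_bigl => j; rewrite ltn_add2l.
by move=> j; rewrite ltnNge ltnW // ltn_addr.
Qed.

Lemma eq_vandermonde n (u v : 'I_n -> F) :
  u =1 v -> vandermonde u = vandermonde v.
Proof.
by move=> e; apply: eq_bigr => i _; apply: eq_bigr => j _; rewrite !e.
Qed.

Lemma vandermonde_pad (q : F) (N : nat) (xs : seq F) : (size xs <= N)%N ->
  vandermonde (@pad F q N xs) =
  vandermonde (fun i : 'I_(size xs) => xs`_i)
  * (\prod_(i < size xs) \prod_(j < N - size xs) (xs`_i - q ^+ j))
  * vandermonde (fun i : 'I_(N - size xs) => q ^+ i).
Proof.
move=> kN; rewrite /pad.
move: (subnKC kN); set n := (N - size xs)%N; clearbody n => eN; subst N.
rewrite vandermonde_split.
have l (i : 'I_(size xs)) :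
    (xs ++ [seq q ^+ m | m <- iota 0 n])`_(lshift n i) = xs`_i.
  by rewrite nth_cat /= ltn_ord.
have r (i : 'I_n) :
    (xs ++ [seq q ^+ m | m <- iota 0 n])`_(rshift (size xs) i) = q ^+ i.
  by rewrite nth_cat /= ltnNge leq_addr addKn (nth_map 0%N) ?size_iota //
    nth_iota.
congr (_ * _ * _); try exact: eq_vandermonde.
by apply: eq_bigr => i _; apply: eq_bigr => j _; rewrite l r.
Qed.

Lemma vandermonde0 (u : 'I_0 -> F) : vandermonde u = 1.
Proof. exact: big_ord0. Qed.

Lemma vandermonde1 (u : 'I_1 -> F) : vandermonde u = 1.
Proof. by rewrite /vandermonde big_ord1 big_pred0 // => j; rewrite [j]ord1. Qed.

(* The factor \det (revmx n) is a sign: qdelta q n is the product of the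
   q^j - q^i over i < j < n. *)
Definition qdelta (q : F) (n : nat) : F :=
  \det (revmx n) * vandermonde (fun i : 'I_n => q ^+ i).

(** The node q^n contributes q^n - q^i = q^i (q - 1) [n - i]_q for each i < n; the sign (-1)^n
    needed to turn the differences around comes from [det_revmx]. *)
Lemma qdeltaS q n : q != 1 ->
  qdelta q n.+1 = qdelta q n * (q ^+ 'C(n, 2) * (q - 1) ^+ n * qfact q n).
Proof.
move=> q1; rewrite /qdelta; have -> : vandermonde (fun i : 'I_n.+1 => q ^+ i) =
    vandermonde (fun i : 'I_n => q ^+ i) * \prod_(i < n) (q ^+ i - q ^+ n).
  rewrite /vandermonde big_ord_recr /= [X in _ * X]big1 ?mulr1; last first.
    by move=> j; rewrite ltnNge -ltnS ltn_ord.
  rewrite -big_split /=; apply: eq_bigr => i _.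
  rewrite big_mkcond big_ord_recr /= ltn_ord; congr (_ * _).
  by rewrite [RHS]big_mkcond.
rewrite !det_revmx binS bin1 exprD.
rewrite mulrACA; congr (_ * _).
have q1' : q - 1 != 0 by rewrite subr_eq0.
rewrite -[n in (-1) ^+ n]card_ord -prodrN /= /qfact big_add1 big_mkord /=.
rewrite -[in (q - 1) ^+ n](card_ord n) -prodr_const -mulrA -big_split /=.
have -> : (q ^+ 'C(n, 2) = \prod_(i < n) q ^+ i).
  rewrite -(big_mkord xpredT (fun i => q ^+ i)) prodrXr /=.
  by rewrite -bin2_sum big_mkord.
rewrite [X in _ * X](reindex_inj rev_ord_inj) -big_split /=.
apply: eq_bigr => i _.
rewrite /qnum [(q - 1) * _]mulrC divfK // opprB mulrBr mulr1 -exprD subnSK //.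
by rewrite subnKC // ltnW.
Qed.

Section NonUnity.

Variable q : F.
Hypotheses (q0 : q != 0) (qX : forall m, (0 < m)%N -> q ^+ m != 1).

Lemma qfact_neq0 n : qfact q n != 0.
Proof.
rewrite /qfact big_add1 big_mkord /=; apply/prodf_neq0 => i _.
by rewrite mulf_neq0 ?invr_eq0 ?subr_eq0 ?qX // -[q]expr1 qX.
Qed.

Lemma qdelta_neq0 n : qdelta q n != 0.
Proof.
have q1 : q != 1 by rewrite -[q]expr1 qX.
elim: n => [|n IHn].
  by rewrite /qdelta vandermonde0 mulr1 det_revmx_neq0.
rewrite qdeltaS // mulf_neq0 // mulf_neq0 ?qfact_neq0 //.
by rewrite mulf_neq0 // expf_neq0 // subr_eq0.
Qed.

(* The exponent of q is the sum over N.+1 - k <= n <= N of 'C(n, 2) - 'C(N, 2). *)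
Lemma qdelta_ratio (N k : nat) : (k <= N.+1)%N ->
  qdelta q N.+1 = qdelta q (N.+1 - k)
    * (q ^ ('C(k.+1, 3)%:Z - (N.+1%:Z - 1) * 'C(k, 2)%:Z)
       * (\prod_(1 <= i < k.+1) qfact q (N.+1 - i))
       * (q ^+ 'C(N, 2) * (q - 1) ^+ N) ^+ k * \prod_(j < k) (q - 1) ^- j).
Proof.
have q1 : q != 1 by rewrite -[q]expr1 qX.
elim: k => [|k IHk] kN.
  by rewrite subn0 big_geq // big_ord0 mulr0 subr0 expr0 !mulr1.
rewrite IHk 1?ltnW // [(N.+1 - k)%N]subSn // qdeltaS // subSS -mulrA.
congr (_ * _).
rewrite [in RHS]big_nat_recr //= subSS big_ord_recr /= [in RHS]exprSr.
have -> : 'C(k.+2, 3)%:Z - (N.+1%:Z - 1) * 'C(k.+1, 2)%:Z =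
    'C(k.+1, 3)%:Z - (N.+1%:Z - 1) * 'C(k, 2)%:Z
    + ('C(N - k, 2)%:Z - 'C(N, 2)%:Z).
  have := bin2_addn (N - k) k; rewrite subnKC // => e.
  by rewrite [in LHS]binS [in X in _ * X]binS bin1; lia.
have -> : (q - 1) ^+ (N - k) = (q - 1) ^+ N / (q - 1) ^+ k.
  by rewrite expfB_cond // subr_eq0 (negbTE q1).
set e := ('C(k.+1, 3)%:Z - _).
rewrite (expfzDr e) // expfzDr // -invr_expz -!exprnP.
move: (q ^ e) => ?.
have qC : q ^+ 'C(N, 2) != 0 by rewrite expf_neq0.
(* The inverse of q^C(N, 2) is about to become an atom for [ring], so the cancelling pair is
   inserted by hand. *)
rewrite -[LHS]mul1r -[X in X * _ = _](mulVf qC).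
move: (q ^+ 'C(N, 2))^-1 ((q - 1) ^- k) (\prod_(_ < _) _) => ? ? ?.
ring.
Qed.

End NonUnity.

End Alternants.

(** * The numerator of s_lambda in the coordinates given by Y *)

Section Coordinates.

Variables (F : fieldType) (q : F) (N : nat) (l : 'I_N.+1 -> int).

Definition powmx : 'M[F]_N.+1 := \matrix_(i, j) (q ^ l j) ^+ (N - i).

(* When powmx is invertible, coords x expresses (x ^ l_j)_j in the rows of powmx;
   otherwise invmx powmx is the junk value powmx. *)
Definition coords (x : F) : 'rV[F]_N.+1 := (\row_j x ^ l j) *m invmx powmx.

(** Reversing the rows gives a Vandermonde matrix with distinct nodes q ^ l_j. *)
Lemma powmx_unit : injective (fun j => q ^ l j) -> powmx \in unitmx.
Proof.
move=> inj; rewrite unitmxE unitfE.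
have := det_mulmx (revmx F N.+1) powmx.
rewrite (@revmx_mul F N.+1 N.+1 (fun i j => (q ^ l j) ^+ i)) => E.
suff : \det (Vandermonde N.+1 (\row_j q ^ l j)) != 0.
  rewrite (_ : Vandermonde _ _ = \matrix_(i, j) (q ^ l j) ^+ i); last first.
    by apply/matrixP => i j; rewrite !mxE.
  by rewrite E mulf_eq0 negb_or => /andP[].
rewrite det_Vandermonde; apply/prodf_neq0 => i _; apply/prodf_neq0 => j ij.
by rewrite !mxE subr_eq0; apply: contraTneq ij => /inj ->; rewrite ltnn.
Qed.

(** The matrix factors as f times Y: since (q^m)^l_j = y_j^m, the row of f for the point q^m is a
    unit vector selecting a row of Y. These unit rows vanish in the first k columns, so f is block
    triangular, and its lower block is [revmx]. *)
Lemma alternant_pad (xs : seq F) : (size xs <= N.+1)%N -> powmx \in unitmx ->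
  \det (\matrix_(i < N.+1, j < N.+1) @pad F q N.+1 xs i ^ l j) =
  \det (\matrix_(i < size xs, j < size xs) coords xs`_i 0 (inord j))
  * \det (revmx F (N.+1 - size xs)) * \det powmx.
Proof.
move=> kN Yu; set k := size xs.
pose f i j : F := if (i < k)%N then coords xs`_i 0 (inord j)
  else (i - k + j.+1 == N.+1)%N%:R.
transitivity (\det ((\matrix_(i < N.+1, j < N.+1) f i j) *m powmx)).
  congr (\det _); apply/matrixP => i j.
  rewrite [LHS]mxE /pad nth_cat -/k; case: ifP => ik.
    transitivity ((coords xs`_i *m powmx) 0 j).
      by rewrite mulmxKV // mxE.
    rewrite !mxE; apply: eq_bigr => p _.
    by rewrite [in RHS]mxE /f ik inord_val.
  have ikN : (i - k < N.+1 - k)%N.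
    by rewrite ltn_sub2r ?(leq_ltn_trans _ (ltn_ord i)) // leqNgt ik.
  rewrite (nth_map 0%N) ?size_iota // nth_iota // add0n.
  have ikN' : (i - k < N.+1)%N by rewrite (leq_trans ikN) // leq_subr.
  rewrite [RHS]mxE (bigD1 (rev_ord (Ordinal ikN'))) //= big1 ?addr0.
    rewrite !mxE /f ik /= subSS -subSn // subnKC ?eqxx ?mul1r; last exact: leqW.
    by rewrite subKn // !exprnP exprzAC.
  move=> p /negbTE pn; rewrite mxE /f ik.
  suff -> : (i - k + p.+1 == N.+1)%N = false by rewrite mul0r.
  apply: contraFF pn => /eqP e; apply/eqP/val_inj => /=.
  move: e; rewrite subSS addnS => -[] /(congr1 (subn^~ (i - k)%N)) <-.
  by rewrite addKn.
rewrite det_mulmx; congr (_ * _); rewrite (@det_block_nat _ _ k) //.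
  congr (_ * _); congr (\det _); apply/matrixP => i j; rewrite mxE [RHS]mxE /f.
    by rewrite ltn_ord.
  rewrite ltnNge leq_addr addKn /= addnS.
  congr (_%:R); congr (nat_of_bool _).
  by rewrite -(eqn_add2l k _ (N.+1 - k)) subnKC // addnCA !addnS.
move=> i j /andP[ki iN] jk; rewrite /f ltnNge ki /=.
suff /ltn_eqF -> : (i - k + j.+1 < N.+1)%N by [].
by apply: leq_ltn_trans iN; rewrite -[leqRHS](subnK ki) leq_add2l.
Qed.

(** [alternant_pad] gives both numerator and, for the empty list, denominator. [\det powmx] cancels,
    and the signs [\det (revmx _)], being their own inverses, complete the Vandermonde products to
    [qdelta]. *)
Lemma normSchur_coords (lam : 'I_N.+1 -> int) (xs : seq F) :
  (forall j, l j = lam j + (N.+1 - j.+1)%:Z) -> powmx \in unitmx ->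
  (size xs <= N.+1)%N ->
  normSchur q lam xs =
  \det (\matrix_(i < size xs, j < size xs) coords xs`_i 0 (inord j))
  / (vandermonde (fun i : 'I_(size xs) => xs`_i)
     * \prod_(i < size xs) \prod_(j < N.+1 - size xs) (xs`_i - q ^+ j))
  * (qdelta q N.+1 / qdelta q (N.+1 - size xs)).
Proof.
move=> lE Yu kN.
have E ys : \matrix_(i < N.+1, j < N.+1)
      pad q ys i ^ (lam j + (N.+1 - j.+1)%:Z) =
    \matrix_(i < N.+1, j < N.+1) pad q ys i ^ l j.
  by apply/matrixP => i j; rewrite !mxE lE.
have Y0 : \det powmx != 0 by rewrite -unitfE -unitmxE.
rewrite /normSchur /schur !E !vandermonde_pad // !alternant_pad //= !subn0.
have R1 n : (\det (revmx F n))^-1 = \det (revmx F n).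
  by rewrite det_revmx invr_sign.
rewrite det_mx00 vandermonde0 big_ord0 /qdelta !invfM !R1 invr1 !mul1r invrK.
rewrite -[RHS]mulr1 -[X in _ = _ * X](mulfV Y0).
rewrite invr1 !mulr1.
do 2!move: (vandermonde _)^-1 => ?.
move: (\det powmx)^-1 (\prod_(i < _) _)^-1 => ? ?.
ring.
Qed.

Hypotheses (q0 : q != 0) (qX : forall m, (0 < m)%N -> q ^+ m != 1).
Hypothesis Yu : powmx \in unitmx.
Variable lam : 'I_N.+1 -> int.
Hypothesis lE : forall j, l j = lam j + (N.+1 - j.+1)%:Z.

(** Case k = 1: by [qdeltaS], each factor under the operator determinant is b(x) times the constant
    kappa = q^C(N, 2) (q - 1)^N. *)
Lemma normSchur1_coords (x : F) : (forall j, x != q ^+ j) ->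
  normSchur q lam [:: x] * (\prod_(1 <= j < N.+1) (x - q ^+ j.-1)) / qfact q N =
  q ^+ 'C(N, 2) * (q - 1) ^+ N * coords x 0 0.
Proof.
move=> xq; have q1 : q != 1 by rewrite -[q]expr1 qX.
rewrite normSchur_coords //= subSS subn0 vandermonde1 det_mx11 mxE.
have -> : inord (ord0 : 'I_1) = ord0 :> 'I_N.+1.
  by apply/val_inj; rewrite /= inordK.
rewrite big_ord1 big_add1 big_mkord /= mul1r qdeltaS //.
have P0 : \prod_(j < N) (x - q ^+ j) != 0.
  by apply/prodf_neq0 => j _; rewrite subr_eq0.
have := qdelta_neq0 q0 qX N; have := qfact_neq0 qX N.
move: P0 (coords x 0 0); move: (\prod_(_ < N) _) (qfact _ _) (qdelta _ _).
move=> p f d p0 c f0 d0.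
move: (q ^+ 'C(N, 2)) ((q - 1) ^+ N) => a b.
by field; rewrite p0 f0 d0.
Qed.

(** Arranged to match the theorem factor by factor: [qdelta_ratio] yields the prefactor, one kappa
    per variable, and the powers of q - 1 that the difference operators produce. *)
Lemma normSchur_det (k : nat) (u : 'I_k -> F) : (k <= N.+1)%N ->
  normSchur q lam [seq u i | i <- enum 'I_k] =
  q ^ ('C(k.+1, 3)%:Z - (N.+1%:Z - 1) * 'C(k, 2)%:Z)
  * (\prod_(1 <= i < k.+1) qfact q (N.+1 - i))
  / (\prod_(i < k) \prod_(1 <= j < (N.+1 - k).+1) (u i - q ^+ j.-1))
  * ((q ^+ 'C(N, 2) * (q - 1) ^+ N) ^+ k
     * (\det (\matrix_(i < k, j < k) coords (u i) 0 (inord j))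
        * \prod_(j < k) (q - 1) ^- j) / vandermonde u).
Proof.
move=> kN; have Ek : size [seq u i | i <- enum 'I_k] = k.
  by rewrite size_map size_enum_ord.
have nu (i : 'I_k) : [seq u i | i <- enum 'I_k]`_i = u i.
  by rewrite (nth_map i) ?nth_ord_enum // size_enum_ord.
move: nu; move: [seq u i | i <- enum 'I_k] Ek => xs Ek nu.
have := @normSchur_coords lam xs lE Yu; rewrite Ek => -> //.
have -> : vandermonde (fun i : 'I_k => xs`_i) = vandermonde u.
  exact: eq_vandermonde.
have -> : \matrix_(i < k, j < k) coords xs`_i 0 (inord j) =
    \matrix_(i, j) coords (u i) 0 (inord j).
  by apply/matrixP => i j; rewrite mxE [RHS]mxE nu.
have -> : \prod_(i < k) \prod_(1 <= j < (N.+1 - k).+1) (u i - q ^+ j.-1) =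
    \prod_(i < k) \prod_(j < N.+1 - k) (xs`_i - q ^+ j).
  by apply: eq_bigr => i _; rewrite nu big_add1 big_mkord.
rewrite (qdelta_ratio q0 qX kN) [qdelta _ _ * _]mulrC mulfK ?qdelta_neq0 //.
rewrite invfM.
move: (\prod_(i < k) \prod_(_ < _) _)^-1 (vandermonde _)^-1 (\det _) => ? ? ?.
move: (q ^ _) ((_ * _) ^+ k) (\prod_(_ < _) _) => ? ? ?.
move: (\prod_(_ <= _ < _) _) => ?.
ring.
Qed.

End Coordinates.

(** * Shifts and difference operators on rational functions *)

Section Operators.

Variables (R : fieldType) (k : nat).

HB.instance Definition _ := GRing.RMorphism.copy (@rfconst R k)
  (@tofrac {mpoly R[k]} \o @mpolyC k R).

(* An alias carrying the proof of q != 0, on which the morphism instances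
   below depend. *)
Definition qshift_morph (q : R) (q0 : q != 0) (i : 'I_k) := qshift q i.

Section Shift.

Variables (q : R) (q0 : q != 0).

Fact qshift_zmod_morphism (i : 'I_k) : zmod_morphism (qshift_morph q0 i).
Proof. by move=> f g; exact: qshiftB. Qed.

Fact qshift_monoid_morphism (i : 'I_k) : monoid_morphism (qshift_morph q0 i).
Proof.
split=> [|f g]; last exact: qshiftM.
by rewrite -(rmorph1 (@rfconst R k)); exact: qshift_const.
Qed.

HB.instance Definition _ i := GRing.isZmodMorphism.Build _ _ (qshift_morph q0 i)
  (qshift_zmod_morphism i).
HB.instance Definition _ i := GRing.isMonoidMorphism.Build _ _
  (qshift_morph q0 i) (qshift_monoid_morphism i).

Local Notation T := (qshift_morph q0).
Local Notation D := (qdiff q).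

Lemma qshift_morphC i c : T i (rfconst c) = rfconst c.
Proof. exact: qshift_const. Qed.

Lemma qshift_var i j :
  T i (rfvar j) = (if j == i then rfconst q else 1) * rfvar j.
Proof.
rewrite /qshift_morph qshift_tofrac // mpqshiftX.
case: ifP => _; last by rewrite mul1r.
by rewrite -mul_mpolyC rmorphM.
Qed.

Lemma iter_qdiffM i m (c f : ratfun R k) :
  T i c = c -> iter m (D i) (c * f) = c * iter m (D i) f.
Proof.
move=> ic; elim: m => //= m ->; rewrite /qdiff -/(T i _) rmorphM /= ic.
by rewrite -mulrBr mulrA.
Qed.

Lemma qshift_iter_qdiff i j m (f : ratfun R k) :
  T j f = f -> T j (iter m (D i) f) = iter m (D i) f.
Proof.
move=> jf; elim: m => //= m IHm; rewrite /qdiff -/(T i _).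
rewrite fmorph_div !rmorphB /= rmorph1 qshift_morphC.
by rewrite /qshift_morph qshift_comm // -!/(T _ _) IHm.
Qed.

(** D_i commutes with multiplication by functions fixed by T_i, so in each Leibniz term it reaches
    only the factor g_i. *)
Lemma opdet_prod (g : 'I_k -> ratfun R k) :
  (forall i j, j != i -> T j (g i) = g i) ->
  opdet (fun i j : 'I_k => iter j (D i)) (\prod_(i < k) g i) =
  \det (\matrix_(i < k, j < k) iter j (D i) (g i)).
Proof.
move=> gT; apply: eq_bigr => s _; congr (_ * _).
transitivity (\prod_i
    (if i \in index_enum 'I_k then iter (s i) (D i) (g i) else g i)); last first.
  by apply: eq_bigr => i _; rewrite mem_index_enum mxE.
(* Only the composition and the membership test now run over r; the products keep all indices, and
   the factors outside r are still untouched. *)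
have := index_enum_uniq 'I_k; move: {1 2 5}(index_enum 'I_k) => r.
elim: r => [|a r IHr] /=; first by rewrite big_nil.
move=> /andP[ar ru]; rewrite big_cons /= IHr //.
rewrite (bigD1 a) //= (negbTE ar) mulrC iter_qdiffM; last first.
  rewrite rmorph_prod; apply: eq_bigr => i ia /=.
  by case: ifP => _; rewrite ?qshift_iter_qdiff // gT // eq_sym.
rewrite [RHS](bigD1 a) //= mem_head mulrC; congr (_ * _).
by apply: eq_bigr => i ia; rewrite in_cons (negbTE ia).
Qed.

(** * The companion matrix and iterated differences of coordinates *)

Variables (N : nat) (l : 'I_N.+1 -> int).
Hypothesis Yu : powmx q l \in unitmx.

Local Notation Y := (powmx q l).
Local Notation Q := (@rfconst R k q).

Definition companion : 'M[R]_N.+1 :=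
  Y *m diag_mx (\row_j q ^ l j) *m invmx Y.

(** Multiplying the row y^(N - p) of Y by y gives row p - 1; only row 0, which becomes y^(N + 1),
    has to be expanded anew. *)
Lemma companion_row (p m : 'I_N.+1) :
  (0 < p)%N -> companion p m = (m.+1 == p)%:R.
Proof.
move=> p0; have pN : (p.-1 < N.+1)%N by rewrite (leq_ltn_trans (leq_pred _)).
transitivity ((Y *m invmx Y) (Ordinal pN) m).
  rewrite /companion mul_mx_diag !mxE; apply: eq_bigr => j _.
  rewrite !mxE -exprSr /=.
  congr (_ ^+ _ * _); have := ltn_ord p; lia.
rewrite mulmxV // mxE; congr (nat_of_bool _)%:R.
by rewrite -[in RHS](prednK p0) eqSS eq_sym.
Qed.

Lemma companion_mul (a : 'cV[R]_N.+1) (p p' : 'I_N.+1) : p = p'.+1 :> nat ->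
  (companion *m a) p 0 = a p' 0.
Proof.
move=> pp'; rewrite mxE (bigD1 p') //= big1 ?addr0.
  by rewrite companion_row pp' // eqxx mul1r.
move=> j jp; rewrite companion_row pp' // eqSS.
by rewrite (negbTE (jp : j != p' :> nat)) mul0r.
Qed.

(* The coordinates of D^m b in the entries of the row vector coords, whose 0-th
   entry is b (see [iter_qdiff_coords]). *)
Definition qdiff_coef (m : nat) : 'cV[R]_N.+1 :=
  iter m (fun a => (q - 1)^-1 *: (companion *m a - a)) (delta_mx 0 0).

Lemma qdiff_coefS m (p : 'I_N.+1) : qdiff_coef m.+1 p 0 =
  (q - 1)^-1 * ((companion *m qdiff_coef m) p 0 - qdiff_coef m p 0).
Proof.
rewrite /qdiff_coef iterS mxE; congr (_ * _); rewrite mxE; congr (_ + _).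
by rewrite mxE.
Qed.

(** [companion] moves entry p - 1 to p, so each step extends the support by at most one index. The
    entry arriving there only gains (q - 1)^-1, whence [qdiff_coef_diag]. *)
Lemma qdiff_coef_gt m (p : 'I_N.+1) : (m < p)%N -> qdiff_coef m p 0 = 0.
Proof.
elim: m p => [|m IHm] p mp; first by rewrite mxE -val_eqE /= gtn_eqF.
rewrite qdiff_coefS (IHm p) ?(ltnW mp) //.
have pN : (p.-1 < N.+1)%N by rewrite (leq_ltn_trans (leq_pred _)).
rewrite (@companion_mul _ p (Ordinal pN)).
  by rewrite IHm ?subr0 ?mulr0 //=; lia.
by rewrite /= prednK // (leq_ltn_trans _ mp).
Qed.

Lemma qdiff_coef_diag (p : 'I_N.+1) : qdiff_coef p p 0 = (q - 1) ^- p.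
Proof.
case: p => m; elim: m => [|m IHm] mN; first by rewrite mxE expr0 invr1.
rewrite qdiff_coefS (@qdiff_coef_gt m) // subr0.
rewrite (@companion_mul _ (Ordinal mN) (Ordinal (ltnW mN))) // IHm.
by rewrite -!exprVn exprS.
Qed.

Lemma powmx_rfconst : powmx Q l = map_mx rfconst Y.
Proof. by apply/matrixP => i j; rewrite !mxE rmorphXn /= fmorphXz. Qed.

(** T_i multiplies x_i^l_j by y_j, fixes the entries of Y^-1, and diag(y) Y^-1 = Y^-1
    [companion]. *)
Lemma qshift_coords (i j : 'I_k) :
  map_mx (T i) (coords Q l (rfvar j)) =
  coords Q l (rfvar j) *m (if j == i then map_mx rfconst companion else 1%:M).
Proof.
rewrite /coords powmx_rfconst -map_invmx map_mxM /= -map_mx_comp.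
have -> : map_mx (T i \o rfconst) (invmx Y) = map_mx rfconst (invmx Y).
  by apply/matrixP => a b; rewrite !mxE /= qshift_morphC.
case: eqP => ij; last first.
  rewrite mulmx1; congr (_ *m _); apply/matrixP => a b.
  by rewrite !mxE fmorphXz /= qshift_var; case: eqP => // _; rewrite mul1r.
rewrite /companion !map_mxM /= !mulmxA.
rewrite -[_ *m map_mx rfconst (invmx Y) *m _]mulmxA -map_mxM mulVmx //.
rewrite map_mx1 mulmx1.
congr (_ *m _); rewrite map_diag_mx mul_mx_diag; apply/matrixP => a b.
by rewrite !mxE fmorphXz /= qshift_var ij eqxx expfzMl mulrC fmorphXz.
Qed.

Lemma iter_qdiff_coords (i : 'I_k) m :
  iter m (D i) (coords Q l (rfvar i) 0 0) =
  (coords Q l (rfvar i) *m map_mx rfconst (qdiff_coef m)) 0 0.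
Proof.
elim: m => [|m IHm] /=.
  by rewrite /qdiff_coef /= map_delta_mx -colE [RHS]mxE.
rewrite IHm /qdiff -/(T i _) -/(qdiff_coef m).
set a := qdiff_coef m; set w := coords _ _ _.
have -> : T i ((w *m map_mx rfconst a) 0 0) =
    (w *m map_mx rfconst (companion *m a)) 0 0.
  transitivity ((map_mx (T i) (w *m map_mx rfconst a)) 0 0).
    by rewrite [RHS]mxE.
  rewrite map_mxM /= qshift_coords eqxx (map_mxM _ companion) /= mulmxA.
  congr ((_ *m _) 0 0); apply/matrixP => b c; rewrite !mxE.
  by rewrite qshift_morphC.
rewrite map_mxZ map_mxB -scalemxAr mulmxBr [RHS]mxE.
rewrite [X in _ = _ * X]mxE [X in _ = _ * (_ + X)]mxE /=.
by rewrite mulrC fmorphV rmorphB rmorph1.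
Qed.

(** The coefficients of D_i^j b(x_i) do not depend on i and vanish beyond index j < k, so the first
    k coordinates suffice and the change of columns U is upper triangular with diagonal (q -
    1)^-j. *)
Lemma det_iter_qdiff_coords : (k <= N.+1)%N ->
  \det (\matrix_(i < k, j < k) iter j (D i) (coords Q l (rfvar i) 0 0)) =
  \det (\matrix_(i < k, j < k) coords Q l (rfvar i) 0 (inord j))
  * \prod_(j < k) (Q - 1) ^- j.
Proof.
move=> kN.
pose U : 'M[ratfun R k]_k := \matrix_(p, j) rfconst (qdiff_coef j (inord p) 0).
have -> : \prod_(j < k) (Q - 1) ^- j = \det U.
  rewrite -det_tr det_trig; last first.
    apply/is_trig_mxP => i j ij; rewrite !mxE qdiff_coef_gt ?rmorph0 //.
    by rewrite inordK // (leq_trans _ kN).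
  apply: eq_bigr => j _; rewrite !mxE.
  have {2}-> : j = (inord j : 'I_N.+1) :> nat.
    by rewrite inordK // (leq_trans _ kN).
  rewrite qdiff_coef_diag inordK ?(leq_trans _ kN) //.
  by rewrite fmorphV rmorphXn rmorphB rmorph1.
rewrite -det_mulmx; congr (\det _); apply/matrixP => i j.
rewrite mxE iter_qdiff_coords [LHS]mxE [RHS]mxE.
pose h p :=
  coords Q l (rfvar i) 0 (inord p) * rfconst (qdiff_coef j (inord p) 0).
transitivity (\sum_(p < N.+1) h p).
  by apply: eq_bigr => p _; rewrite /h inord_val [X in _ * X = _]mxE.
transitivity (\sum_(p < k) h p); last first.
  by apply: eq_bigr => p _; rewrite [in RHS]mxE [X in _ = _ * X]mxE.
rewrite (big_ord_widen N.+1 h kN) [RHS]big_mkcond; apply: eq_bigr => p _.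
case: ltnP => // kp; rewrite /h inord_val qdiff_coef_gt ?rmorph0 ?mulr0 //.
exact: leq_trans kp.
Qed.

End Shift.

End Operators.

(** * Formal variables and the assembly of the identity *)

Lemma rfvar_neq (R : fieldType) (k : nat) (i : 'I_k) (c : R) :
  rfvar i != rfconst c.
Proof.
(* At the point c + 1 the two polynomials differ by 1. *)
rewrite tofrac_eq; apply/eqP => /(congr1 (meval (fun=> c + 1))).
rewrite mevalXU mevalC => /eqP; rewrite -subr_eq0 addrC addKr.
by rewrite oner_eq0.
Qed.

Theorem theorem3p5 (R : realFieldType) (q : R) (q_gt0 : 0 < q) (q_neq1 : q != 1)
    (k N : nat) (k_ge1 : (1 <= k)%N) (k_leN : (k <= N)%N)
    (lam : 'I_N -> int) (lam_sig : signature lam) :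
  let x : 'I_k -> ratfun R k := rfvar in
  let Q : ratfun R k := rfconst q in
  normSchur Q lam [seq x i | i <- enum 'I_k] =
    Q ^ ('C(k.+1, 3)%:Z - (N%:Z - 1) * 'C(k, 2)%:Z)
      * (\prod_(1 <= i < k.+1) qfact Q (N - i))
      / (\prod_(i < k) \prod_(1 <= j < (N - k).+1) (x i - Q ^+ j.-1))
    * (opdet (fun i j : 'I_k => iter j (qdiff q i))
         (\prod_(i < k) (normSchur Q lam [:: x i]
            * (\prod_(1 <= j < N) (x i - Q ^+ j.-1)) / qfact Q N.-1))
       / vandermonde x).
Proof.
move=> x Q.
case: N => [|N] in lam lam_sig k_leN *; first by case: k k_ge1 k_leN x Q => [].
have q0 : q != 0 by rewrite gt_eqF.
have qX m : (0 < m)%N -> Q ^+ m != 1.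
  by move=> m0; rewrite -rmorphXn fmorph_eq1 pexpr_eq1 // ltW.
have Q0 : Q != 0 by rewrite fmorph_eq0.
pose l (j : 'I_N.+1) : int := lam j + (N.+1 - j.+1)%:Z.
(* A weakly decreasing signature plus a strictly decreasing staircase is strictly decreasing. *)
have l_inj : injective l.
  move=> i j; rewrite /l => e; apply/val_inj => /=.
  have [ij|ji|//] := ltngtP i j.
    by have := lam_sig _ _ (ltnW ij); have := ltn_ord j; move: e; lia.
  by have := lam_sig _ _ (ltnW ji); have := ltn_ord i; move: e; lia.
have Yu : powmx q l \in unitmx.
  by apply: powmx_unit => i j /(ieexprIz q_gt0 q_neq1)/l_inj.
have YQ : powmx Q l \in unitmx by rewrite powmx_rfconst map_unitmx.
have lE j : l j = lam j + (N.+1 - j.+1)%:Z by [].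
rewrite (normSchur_det Q0 qX YQ lE) //.
congr (_ * (_ / _)).
have kappaE : Q ^+ 'C(N, 2) * (Q - 1) ^+ N =
    rfconst (q ^+ 'C(N, 2) * (q - 1) ^+ N).
  by rewrite rmorphM !rmorphXn rmorphB rmorph1.
under [in RHS]eq_bigr => i _.
  rewrite (normSchur1_coords Q0 qX YQ lE); last first.
    by move=> j; rewrite -rmorphXn rfvar_neq.
  rewrite kappaE; over.
rewrite (opdet_prod (q0 := q0)); last first.
  move=> i j ji; rewrite rmorphM /= qshift_morphC; congr (_ * _).
  have := qshift_coords q0 Yu j i; rewrite eq_sym (negbTE ji) mulmx1.
  by move/matrixP/(_ 0 0); rewrite mxE.
(* kappa^k is spread over the k rows; being constant, kappa passes through each D_i. *)
rewrite kappaE -(det_iter_qdiff_coords q0 Yu) // -detZ.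
congr (\det _); apply/matrixP => i j.
rewrite [LHS]mxE [RHS]mxE [X in _ * X = _]mxE.
by rewrite (iter_qdiffM (q0 := q0)) ?qshift_morphC.
Qed.
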